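(* Let $(\mathbb{S},\Sigma)$ be a measurable space, let a sequence of measures $\{\mu_n\}_{n\ge 1}$ on $(\mathbb{S},\Sigma)$ converge setwise to a finite measure $\mu$, and let $\{f_n\}_{n\ge 1}$ be a sequence of $[-\infty,+\infty]$-valued measurable functions on $\mathbb{S}$. All integrals appearing in this statement are assumed to be defined. If $\{f_n\}_{n\ge 1}$ lower semi-converges to a measurable real-valued function $f$ in measure $\mu$ and $\{f_n^-\}_{n\ge 1}$ is asymptotically uniformly integrable with respect to $\{\mu_n\}_{n\ge 1}$, then $$\int_{\mathbb{S}} f(s)\,\mu(ds)\le\liminf_{n\to\infty}\int_{\mathbb{S}} f_n(s)\,\mu_n(ds).$$
   Context: For a function $h$, $h^+=\max\{h,0\}$ and $h^-=-\min\{h,0\}$. The integral $\int h\,d\mu$ of a measurable $[-\infty,+\infty]$-valued function is defined if $\min\{\int h^+d\mu,\int h^-d\mu\}<+\infty$, and then equals $\int h^+d\mu-\int h^-d\mu$. Setwise convergence: $\mu_n(C)\to\mu(C)$ for every $C\in\Sigma$. Lower semi-convergence in measure: measurable functions $f_n$ lower semi-converge to a measurable real-valued $f$ in measure $\mu$ if for each $\varepsilon>0$, $\mu(\{s: f_n(s)\le f(s)-\varepsilon\})\to 0$ as $n\to\infty$. Asymptotic uniform integrability: $\{h_n\}$ is asymptotically uniformly integrable with respect to $\{\mu_n\}$ if $\lim_{K\to+\infty}\limsup_{n\to\infty}\int |h_n(s)|\,\mathbf{1}\{|h_n(s)|\ge K\}\,\mu_n(ds)=0$. *)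

(* Defs.v *)
From mathcomp Require Import all_boot all_order all_algebra.
From mathcomp Require Import all_classical all_reals all_analysis.
From mathcomp Require Import measurable_realfun.

Set Implicit Arguments.
Unset Strict Implicit.
Unset Printing Implicit Defensive.

Import Order.TTheory GRing.Theory Num.Theory.
Import numFieldNormedType.Exports.

Local Open Scope classical_set_scope.
Local Open Scope ring_scope.
Local Open Scope ereal_scope.

(* The library integral is total: it sets +oo - +oo = -oo. This predicate
   excludes that case. *)
Definition integral_defined (d : measure_display) (T : measurableType d)
    (R : realType) (mu : {measure set T -> \bar R}) (h : T -> \bar R) : Prop :=
  mine (\int[mu]_x h^\+ x) (\int[mu]_x h^\- x) < +oo.

Definition setwise_cvg (d : measure_display) (T : measurableType d)
    (R : realType) (mu_ : {measure set T -> \bar R}^nat)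
    (mu : {measure set T -> \bar R}) : Prop :=
  forall C : set T, measurable C -> mu_ n C @[n --> \oo] --> mu C.

Definition lower_semicvg_in_measure (d : measure_display)
    (T : measurableType d) (R : realType) (mu : {measure set T -> \bar R})
    (f_ : (T -> \bar R)^nat) (f : T -> R) : Prop :=
  forall e : R, (0 < e)%R ->
    mu [set s | f_ n s <= (f s - e)%:E] @[n --> \oo] --> 0.

Definition asymptotically_uniformly_integrable (d : measure_display)
    (T : measurableType d) (R : realType)
    (mu_ : {measure set T -> \bar R}^nat) (h_ : (T -> \bar R)^nat) : Prop :=
  (fun K : R => limn_esup (fun n => \int[mu_ n]_s
    (`|h_ n s| * (\1_[set t | (K%:E <= `|h_ n t|)%E] s)%:E)))
    @ +oo%R --> 0.

(* Main.v *)
Require Import Defs.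
From mathcomp Require Import all_boot all_order all_algebra.
From mathcomp Require Import all_classical all_reals all_analysis.
From mathcomp Require Import measurable_realfun.
From mathcomp Require Import ring lra.

Import Order.TTheory GRing.Theory Num.Theory.
Import numFieldNormedType.Exports.
Import HBNNSimple.

Local Open Scope classical_set_scope.
Local Open Scope ring_scope.
Local Open Scope ereal_scope.

(** Fix a simple function s with 0 <= s <= f^+ and put g = s - f^-, so that
    g <= f and g <= M for some M. If f_n is cut off below at -K, then
    f_n >= max(f_n, -K) - f_n^- 1{f_n^- >= K}, and max(f_n, -K) >= g - e outside
    A_n = {f_n <= f - e}, while g exceeds -K by at most K + M on A_n. Moving all
    negative terms to the other side gives an inequality between nonnegative
    functions that can be integrated against mu_n. As n grows, mu_n(A_n)
    vanishes (a weak form of Vitali-Hahn-Saks), the tail is small for K large,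
    and the integral of the nonnegative function max(g + K, 0) is lower
    semicontinuous under setwise convergence. It remains to take the supremum
    over s. *)

(** * Extended-real limits turned into eventual inequalities *)

Lemma cvge_near_lt (R : realFieldType) (I : Type) (F : set_system I)
    (FF : Filter F) (u : I -> \bar R) (l a : \bar R) :
  u @ F --> l -> l < a -> \forall i \near F, u i < a.
Proof.
move=> ul la; apply: (ul [set y | y < a]); apply: open_nbhs_nbhs.
by split => //; exact: open_ereal_lt_ereal.
Qed.

Lemma cvge_near_gt (R : realFieldType) (I : Type) (F : set_system I)
    (FF : Filter F) (u : I -> \bar R) (l a : \bar R) :
  u @ F --> l -> a < l -> \forall i \near F, a < u i.
Proof.
move=> ul la; apply: (ul [set y | a < y]); apply: open_nbhs_nbhs.
by split => //; exact: open_ereal_gt_ereal.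
Qed.

Lemma limn_esup_near_lt (R : realType) (u : nat -> \bar R) (a : \bar R) :
  limn_esup u < a -> \forall n \near \oo, u n < a.
Proof.
move=> /ereal_inf_lt[_ [V FV <-]] supVa; apply: filterS FV => n Vn.
by apply: le_lt_trans supVa; apply: ereal_sup_ubound; exists n.
Qed.

(** The set of [n] with [a <= u n] is itself one of the sets over which the infimum defining the
    upper limit of [\- u] is taken. *)
Lemma near_ge_limn_einf (R : realType) (u : nat -> \bar R) (a : \bar R) :
  (\forall n \near \oo, a <= u n) -> a <= limn_einf u.
Proof.
move=> ua; rewrite leeNr; apply: (@le_trans _ _
  (ereal_sup [set (\- u) n | n in [set n | a <= u n]])).
  by apply: ereal_inf_lbound; exists [set n | a <= u n].
by apply: ge_ereal_sup => _ [n /= an <-]; rewrite leeN2.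
Qed.

(** * Integrals and small sets under setwise convergence *)

Section setwise.
Context (d : measure_display) (T : measurableType d) (R : realType).
Variables (mu_ : nat -> {measure set T -> \bar R}).
Variable (mu : {measure set T -> \bar R}).
Hypothesis mu_cvg : setwise_cvg mu_ mu.

Lemma setwise_cvg_sintegral (s : {nnsfun T >-> R}) :
  sintegral (mu_ n) s @[n --> \oo] --> sintegral mu s.
Proof.
under eq_fun do rewrite sintegralE fsbig_finite//=.
rewrite sintegralE fsbig_finite//=.
apply: cvg_nnesum => r _.
  near=> n; apply: (mulemu_ge0 (fun x => s @^-1` [set x])) => r0.
  by rewrite preimage_nnfun0.
by apply: cvgeZl => //; exact: mu_cvg.
Unshelve. all: by end_near. Qed.

(** Lower semicontinuity: some simple function below [h] already has [mu]-integral above [a], and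
    its integrals converge. *)
Lemma setwise_cvg_integral_near_gt (h : T -> \bar R) (a : \bar R) :
  (forall x, 0 <= h x) -> a < \int[mu]_x h x ->
  \forall n \near \oo, a < \int[mu_ n]_x h x.
Proof.
move=> h0; rewrite ge0_integralTE// => /ereal_sup_gt[_ [s sh <-] as_].
apply: filterS (cvge_near_gt _ _ _ _ _ _ _ (setwise_cvg_sintegral s) as_).
move=> n /lt_le_trans; apply; rewrite ge0_integralTE//.
by apply: ereal_sup_ubound; exists s.
Qed.

(* If [mu_ n (A n) >= e] infinitely often, extract [A (k i)] with
   [mu (A (k i)) <= e / 2 ^ i.+2]: their union [B] has [mu B < e], while
   [mu_ (k i) B >= e] for every [i]. *)
Lemma setwise_cvg_measure_cvg0 (A : nat -> set T) :
  (forall n, measurable (A n)) -> mu (A n) @[n --> \oo] --> 0 ->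
  mu_ n (A n) @[n --> \oo] --> 0.
Proof.
move=> mA A0; apply/fine_cvgP.
suff small (e : R) : (0 < e)%R -> \forall n \near \oo, mu_ n (A n) < e%:E.
  have fin : \forall n \near \oo, mu_ n (A n) \is a fin_num.
    apply: filterS (small 1%R ltr01) => n An.
    by rewrite ge0_fin_numE//; exact: lt_trans An (ltry _).
  split => //; apply/cvgrPdist_lt => e e0.
  apply: filterS2 fin (small e e0) => n fn.
  by rewrite sub0r normrN ger0_norm ?fine_ge0// -lte_fin fineK.
move=> e0; apply: contrapT => nsmall.
have ex i : exists k, [/\ (i <= k)%N, mu (A k) < (e / 2 / (2 ^ i.+1)%:R)%:E &
    e%:E <= mu_ k (A k)].
  apply: contrapT => nk; apply: nsmall.
  have Ai : \forall n \near \oo, mu (A n) < (e / 2 / (2 ^ i.+1)%:R)%:E.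
    apply: cvge_near_lt A0 _.
    by rewrite lte_fin !divr_gt0// ltr0n expn_gt0.
  apply: filterS2 (nbhs_infty_ge i) Ai => n ni Ai.
  by rewrite ltNge; apply/negP => ein; apply: nk; exists n.
have [k kP] := choice ex.
pose B := \bigcup_i A (k i).
have mB : measurable B by exact: bigcup_measurable.
have muB : mu B < e%:E.
  (* The geometric sum gives only a non-strict bound, so it is taken with [e / 2]. *)
  apply: (@le_lt_trans _ _ (e / 2)%:E); last by rewrite lte_fin; lra.
  apply: (@le_trans _ _ (\sum_(i <oo) mu (A (k i)))).
    exact: measure_sigma_subadditive.
  apply: le_trans (@epsilon_trick0 R (e / 2) xpredT _); last by lra.
  by apply: lee_nneseries => // i _; have [_ /ltW] := kP i.
have [N _ NB] := cvge_near_lt _ _ _ _ _ _ _ (mu_cvg _ mB) muB.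
have [Nk _ eA] := kP N.
have AB : mu_ (k N) (A (k N)) <= mu_ (k N) B.
  by apply: le_measure; rewrite ?inE//; exact: bigcup_sup.
by have := le_lt_trans (le_trans eA AB) (NB _ Nk); rewrite ltxx.
Qed.

End setwise.

(** * Truncation at -K, pointwise and integrated *)

Section truncation.
Context (d : measure_display) (T : measurableType d) (R : realType).
Implicit Types (nu : {measure set T -> \bar R}) (phi : T -> \bar R).

(** Here [z], [r] stand for values of f_n, f. If [z <= r - e], the term [K + M] pays for the first
    summand, and z^- is at most K plus its tail; otherwise [g < z + e]. At z = -oo the tail makes
    the right side infinite. *)
Lemma truncated_le (z : \bar R) (r g K M e : R) :
  (0 <= K)%R -> (0 <= M)%R -> (0 <= e)%R -> (g <= r)%R -> (g <= M)%R ->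
  (Num.max (g + K) 0)%:E + maxe (- z) 0 <=
  maxe z 0 + ((K + e)%:E + ((K + M)%:E * (z <= (r - e)%:E)%E%:R%:E +
    `|maxe (- z) 0| * (K%:E <= `|maxe (- z) 0|)%E%:R%:E)).
Proof.
move=> K0 M0 e0 gr gM; case: z => [z| |].
- rewrite -EFinN -!EFin_max.
  rewrite [`|_%:E|]/= ger0_norm; last by rewrite le_max lexx orbT.
  rewrite -!EFinM -!EFinD !lee_fin.
  case: (leP z (r - e)%R); case: (leP (- z)%R 0%R); case: (leP z 0%R);
    case: (leP (g + K)%R 0%R); case: (leP K) => /=; lra.
- by rewrite /= maxNye maxye abse0 mul0e adde0 -EFinM -EFinD addye// leey.
- by rewrite /= maxye maxNye leey/= mule1 addeC addye.
Qed.

Lemma measurable_fun_funeneg_tail phi (K : R) :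
  measurable_fun setT phi ->
  measurable_fun setT (fun x =>
    `|phi^\- x| * (\1_[set t | (K%:E <= `|phi^\- t|)%E] x)%:E).
Proof.
move=> mphi.
have mabs : measurable_fun setT (fun x => `|phi^\- x|).
  by apply: measurableT_comp => //; exact: measurable_funeneg.
apply: emeasurable_funM => //; apply/measurable_EFinP/measurable_indic.
by rewrite -[X in measurable X]setTI; exact: measurable_lee.
Qed.

Lemma truncated_integral_le nu phi (f g : T -> R) (K M e : R) :
  (0 <= K)%R -> (0 <= M)%R -> (0 <= e)%R ->
  measurable_fun setT phi -> measurable_fun setT f -> measurable_fun setT g ->
  (forall x, g x <= f x)%R -> (forall x, g x <= M)%R ->
  \int[nu]_x (Num.max (g x + K) 0)%:E + \int[nu]_x phi^\- x <=
  \int[nu]_x phi^\+ x + ((K + e)%:E * nu setT +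
    ((K + M)%:E * nu [set x | phi x <= (f x - e)%:E] +
     \int[nu]_x (`|phi^\- x| * (\1_[set t | (K%:E <= `|phi^\- t|)%E] x)%:E))).
Proof.
move=> K0 M0 e0 mphi mf mg gf gM.
have mA : measurable [set x | phi x <= (f x - e)%:E].
  rewrite -[X in measurable X]setTI; apply: measurable_lee => //.
  by apply/measurable_EFinP; exact: measurable_funB.
have mtail := measurable_fun_funeneg_tail phi K mphi.
have mind : measurable_fun setT (fun x => (K + M)%:E *
    (\1_[set x | (phi x <= (f x - e)%:E)%E] x)%:E).
  by apply: emeasurable_funM => //; apply/measurable_EFinP/measurable_indic.
have KM0 : (0 <= K + M)%R by lra.
have Ke0 : (0 <= K + e)%R by lra.
have ind0 (A : set T) x : 0 <= (\1_A x)%:E :> \bar R by rewrite lee_fin.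
rewrite -ge0_integralD//; last 3 first.
- by move=> x _; rewrite lee_fin le_max lexx orbT.
- apply/measurable_EFinP; apply: measurable_maxr => //.
  exact: measurable_funD.
- exact: measurable_funeneg.
have -> : nu [set x | phi x <= (f x - e)%:E] =
    \int[nu]_x (\1_[set x | (phi x <= (f x - e)%:E)%E] x)%:E.
  by rewrite integral_indic// setIT.
rewrite -integral_cst// -ge0_integralZl_EFin//; last first.
  by apply/measurable_EFinP/measurable_indic.
rewrite -ge0_integralD//; last by move=> x _; rewrite mule_ge0.
rewrite -ge0_integralD//; last 2 first.
- by move=> x _; rewrite adde_ge0// mule_ge0.
- exact: emeasurable_funD.
rewrite -ge0_integralD//; last 3 first.
- exact: measurable_funepos.
- by move=> x _; rewrite adde_ge0 ?lee_fin// adde_ge0// mule_ge0.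
- by apply: emeasurable_funD => //; exact: emeasurable_funD.
apply: ge0_le_integral => //.
- by move=> x _; rewrite adde_ge0// lee_fin le_max lexx orbT.
- apply: emeasurable_funD; last exact: measurable_funeneg.
  apply/measurable_EFinP; apply: measurable_maxr => //.
  exact: measurable_funD.
- apply: emeasurable_funD; first exact: measurable_funepos.
  by apply: emeasurable_funD => //; exact: emeasurable_funD.
- move=> x _; rewrite !indicE ![x \in _]asboolb !(funenegE, funeposE).
  exact: truncated_le.
Qed.

(** Off the tail set phi^- is below K. A finite right side makes the integral of phi^- finite, so
    that it can be cancelled in [truncated_integral_le]. *)
Lemma integral_funeneg_le nu phi (K : R) :
  (0 <= K)%R -> measurable_fun setT phi ->
  \int[nu]_x phi^\- x <= K%:E * nu setT +
   \int[nu]_x (`|phi^\- x| * (\1_[set t | (K%:E <= `|phi^\- t|)%E] x)%:E).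
Proof.
move=> K0 mphi.
have mN : measurable_fun setT phi^\- by exact: measurable_funeneg.
have mtail := measurable_fun_funeneg_tail phi K mphi.
rewrite -integral_cst// -ge0_integralD//.
apply: ge0_le_integral => //.
- exact: emeasurable_funD.
- move=> x _; rewrite gee0_abs ?funeneg_ge0// indicE.
  case: (boolP (_ \in _)) => [_|]; first by rewrite mule1 leeDr ?lee_fin.
  rewrite notin_setE/= => /negP; rewrite -ltNge mule0 adde0.
  by rewrite gee0_abs ?funeneg_ge0// => /ltW.
Qed.

End truncation.

(** * Passage to the lower limit *)

Theorem theorem4p4 (d : measure_display) (T : measurableType d) (R : realType)
    (mu_ : nat -> {measure set T -> \bar R})
    (mu : {finite_measure set T -> \bar R})
    (f_ : nat -> T -> \bar R) (f : T -> R)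
    (mu_cvg : setwise_cvg mu_ mu)
    (mf_ : forall n, measurable_fun [set: T] (f_ n))
    (mf : measurable_fun [set: T] f)
    (df_ : forall n, integral_defined (mu_ n) (f_ n))
    (df : integral_defined mu (EFin \o f))
    (f_cvg : lower_semicvg_in_measure mu f_ f)
    (f_aui : asymptotically_uniformly_integrable mu_ (fun n => (f_ n)^\-)) :
  \int[mu]_s (f s)%:E <= limn_einf (fun n => \int[mu_ n]_s f_ n s).
Proof.
pose fN x := Num.max (- f x)%R 0%R.
have fNE x : (EFin \o f)^\- x = (fN x)%:E by rewrite funenegE -EFinN -EFin_max.
have mfN : measurable_fun setT fN.
  by apply: measurable_maxr => //; exact: measurableT_comp.
have fN0 x : (0 <= fN x)%R by rewrite le_max lexx orbT.
rewrite integralE.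
have Q0 : 0 <= \int[mu]_x (EFin \o f)^\- x by exact: integral_ge0.
(* If f^- has infinite integral, the left-hand side is -oo. *)
have [Qy|Qfin] := eqVneq (\int[mu]_x (EFin \o f)^\- x) +oo.
  move: df; rewrite /integral_defined Qy gt_min ltxx orbF => fpos.
  by rewrite addeNy leNye.
have {}Qfin : \int[mu]_x (EFin \o f)^\- x \is a fin_num.
  by rewrite ge0_fin_numE// ltey.
set Q := fine (\int[mu]_x (EFin \o f)^\- x).
have QE : \int[mu]_x (EFin \o f)^\- x = Q%:E by rewrite fineK.
(* If the claim fails, some simple [s <= f^+] has integral above the lower limit plus [Q]. The rest
   refutes this by showing that [S - Q] is at most the lower limit. *)
rewrite leNgt; apply/negP; rewrite QE lteBrDr// ge0_integralTE//.
move=> /ereal_sup_gt[_ [s sf <-]].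
have [M [M0 sM]] : exists M : R, (0 <= M)%R /\ forall x, (s x <= M)%R.
  have [A [_ sA]] := simple_bounded s.
  exists (Num.max 0 (A + 1))%R; split; first by rewrite le_max lexx.
  move=> x; rewrite le_max; apply/orP; right.
  by rewrite (le_trans (ler_norm _))// sA// ltrDl.
pose m := fine (mu setT).
have mE : (mu : {measure set T -> \bar R}) setT = m%:E.
  by rewrite fineK// fin_num_measure.
have m0 : (0 <= m)%R by rewrite fine_ge0.
have Sfin : sintegral mu s \is a fin_num.
  rewrite -integralT_nnsfun ge0_fin_numE; last first.
    by apply: integral_ge0 => x _; rewrite lee_fin.
  apply: (@le_lt_trans _ _ (\int[mu]_x cst M%:E x)).
    apply: ge0_le_integral => //.
    - by move=> x _; rewrite lee_fin.
    - exact/measurable_EFinP.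
    - by move=> x _; rewrite lee_fin.
  by rewrite integral_cst// mE -EFinM ltry.
set S := fine (sintegral mu s).
have SE : sintegral mu s = S%:E by rewrite fineK.
rewrite SE -lteBrDr// ltNge -EFinB => /negP; apply.
apply/lee_addgt0Pr => eta eta0; rewrite -leeBlDr// -EFinB.
apply: near_ge_limn_einf.
(* Five errors of size at most [de]: the tail, the loss in [near_h], [e * m], the excess of
   [mu_ n setT] over [m] times [K + e], and the exceptional set times [K + M]. *)
have de0 : (0 < eta / 5)%R by lra.
set de := (eta / 5)%R in de0.
have /(pinfty_ex_gt (num_real 0%R))[K K0 tailK] :
    \forall K \near +oo%R, limn_esup (fun n => \int[mu_ n]_s
      (`|(f_ n)^\- s| * (\1_[set t | (K%:E <= `|(f_ n)^\- t|)%E] s)%:E)) <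
    de%:E.
  by apply: cvge_near_lt f_aui _; rewrite lte_fin.
(* The denominator is [m + 1] because [m] may be 0. *)
pose e := (de / (m + 1))%R.
have e0 : (0 < e)%R by rewrite divr_gt0//; lra.
have em : (e * m <= de)%R.
  by rewrite /e mulrAC ler_pdivrMr; nra.
pose g x := (s x - fN x)%R.
have mg : measurable_fun setT g by exact: measurable_funB.
have gf x : (g x <= f x)%R.
  have := sf x; rewrite funeposE -EFin_max lee_fin /g /fN.
  by case: (leP (f x) 0%R); case: (leP (- f x)%R 0%R); lra.
have gM x : (g x <= M)%R by have := sM x; have := fN0 x; rewrite /g; lra.
(* Adding f^- to both sides reduces this to integrating [s + K <= max(g + K, 0) + f^-], where all
   terms are nonnegative. *)
have hS : (S + K * m - Q)%:E <= \int[mu]_x (Num.max (g x + K) 0)%:E.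
  rewrite EFinB leeBlDr// -QE EFinD EFinM -SE -mE -integralT_nnsfun.
  have sp x : setT x -> 0 <= (s x)%:E by move=> _; rewrite lee_fin.
  have hp x : setT x -> 0 <= (Num.max (g x + K) 0)%:E.
    by move=> _; rewrite lee_fin le_max lexx orbT.
  have mh : measurable_fun setT (fun x => (Num.max (g x + K) 0)%:E).
    apply/measurable_EFinP; apply: measurable_maxr => //.
    exact: measurable_funD.
  have mfE : measurable_fun setT (EFin \o f)^\-.
    by apply: measurable_funeneg; exact/measurable_EFinP.
  have msE : measurable_fun setT (EFin \o s) by exact/measurable_EFinP.
  rewrite -integral_cst// -ge0_integralD//; last first.
    by move=> x _; rewrite lee_fin ltW.
  rewrite -ge0_integralD//; apply: ge0_le_integral => //.
  - by move=> x _; apply: adde_ge0; rewrite lee_fin// ltW.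
  - exact: emeasurable_funD.
  - exact: emeasurable_funD.
  - move=> x _; rewrite fNE -!EFinD lee_fin /g.
    by case: (leP (s x - fN x + K)%R 0%R); lra.
have near_h : \forall n \near \oo,
    (S + K * m - Q - de)%:E < \int[mu_ n]_x (Num.max (g x + K) 0)%:E.
  apply: (setwise_cvg_integral_near_gt _ _ _ _ _ mu_cvg).
    by move=> x; rewrite lee_fin le_max lexx orbT.
  by apply: lt_le_trans hS; rewrite lte_fin; lra.
have near_m : \forall n \near \oo,
    mu_ n setT < (m + de / (K + e))%:E.
  apply: cvge_near_lt (mu_cvg _ measurableT) _.
  rewrite mE lte_fin ltrDl divr_gt0//; lra.
have near_A : \forall n \near \oo,
    mu_ n [set x | f_ n x <= (f x - e)%:E] < (de / (K + M + 1))%:E.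
  apply: (@cvge_near_lt _ _ _ _ _ 0); last by rewrite lte_fin divr_gt0//; lra.
  apply: (setwise_cvg_measure_cvg0 _ _ _ _ _ mu_cvg); last exact: f_cvg.
  move=> n; rewrite -[X in measurable X]setTI; apply: measurable_lee => //.
  by apply/measurable_EFinP; exact: measurable_funB.
have finP (x : \bar R) (r : R) : 0 <= x -> x < r%:E ->
    exists2 y : R, x = y%:E & (0 <= y < r)%R.
  move=> x0 xr; have xfin : x \is a fin_num.
    by rewrite ge0_fin_numE//; exact: lt_trans xr (ltry _).
  by exists (fine x); rewrite ?fineK// fine_ge0//= -lte_fin fineK.
near=> n.
rewrite [leRHS]integralE.
have := truncated_integral_le _ _ _ (mu_ n) (f_ n) f g K M e
  (ltW K0) M0 (ltW e0) (mf_ n) mf mg gf gM.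
have := integral_funeneg_le _ _ _ (mu_ n) (f_ n) K (ltW K0) (mf_ n).
(* The total mass, the exceptional mass and the tail become reals [t], [a], [b], so that the final
   estimate is real arithmetic. *)
have [t -> /andP[t0 tm]] : exists2 t, mu_ n setT = t%:E &
    (0 <= t < m + de / (K + e))%R.
  by apply: finP => //; near: n.
have [a -> /andP[a0 aA]] : exists2 a,
    mu_ n [set x | f_ n x <= (f x - e)%:E] = a%:E &
    (0 <= a < de / (K + M + 1))%R.
  by apply: finP => //; near: n.
have [b -> /andP[b0 bde]] : exists2 b, \int[mu_ n]_x (`|(f_ n)^\- x| *
    (\1_[set t | (K%:E <= `|(f_ n)^\- t|)%E] x)%:E) = b%:E & (0 <= b < de)%R.
  apply: finP; first by apply: integral_ge0 => x _; rewrite mule_ge0// lee_fin.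
  near: n; exact: limn_esup_near_lt.
have : (S + K * m - Q - de)%:E < \int[mu_ n]_x (Num.max (g x + K) 0)%:E.
  by near: n.
have p0 : 0 <= \int[mu_ n]_x (f_ n)^\+ x by exact: integral_ge0.
have q0 : 0 <= \int[mu_ n]_x (f_ n)^\- x by exact: integral_ge0.
move: p0 q0; set p := \int[_]_x _^\+ _; set q := \int[_]_x _^\- _.
set H := \int[_]_x _ => p0 q0 HS; rewrite -!EFinM -!EFinD => qK.
(* Finiteness of [q] allows it to be added to the strict bound on [H] and then subtracted; [p] may
   still be +oo, and then the goal is trivial. *)
have [r -> _] : exists2 r, q = r%:E & (0 <= r < K * t + b + 1)%R.
  by apply: finP => //; apply: le_lt_trans qK _; rewrite lte_fin ltrDl.
move=> Hp; move: HS; rewrite -(@lteD2rE _ r%:E)// => /lt_le_trans/(_ Hp).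
case: (p) p0 => [p' _|_ _|//]; last by rewrite addye// leey.
rewrite -!EFinD lee_fin lte_fin => ineq.
have Ket : ((K + e) * t <= K * m + 2 * de)%R.
  have : ((K + e) * t <= (K + e) * (m + de / (K + e)))%R.
    by apply: ler_wpM2l; lra.
  have -> : ((K + e) * (m + de / (K + e)) = K * m + e * m + de)%R.
    by field; rewrite gt_eqF// addr_gt0.
  lra.
have KMa : ((K + M) * a <= de)%R.
  have : (a * (K + M + 1) < de)%R by rewrite -ltr_pdivlMr; lra.
  by rewrite mulrDr mulr1; lra.
have etaE : (eta = 5 * de)%R by rewrite /de; field.
rewrite etaE; lra.
Unshelve. all: by end_near.
Qed.
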